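(* There exists a function $f:\mathbb{N}\to\mathbb{N}$ such that the following holds. Let $j$ and $m$ be positive integers and let $G$ be a finite group that possesses $m$ cyclic subgroups whose union contains all $\gamma_j^*$-commutators of $G$. Then $\gamma_j^*(G)$ contains a subgroup $\Delta$ of order at most $f(m)$ which is normal in $G$ and such that $\gamma_j^*(G)/\Delta$ is cyclic.
   Context: Let $G$ be a finite group; $|a|$ denotes the order of an element $a$ and $[a,b]=a^{-1}b^{-1}ab$. The $\gamma_j^*$-commutators of $G$ are defined recursively. Every element of $G$ is a $\gamma_1^*$-commutator. For $j\geq 2$, let $X$ be the set of all elements of $G$ that are powers of $\gamma_{j-1}^*$-commutators; an element $g\in G$ is a $\gamma_j^*$-commutator if there exist $a\in X$ and $b\in G$ such that $g=[a,b]$ and $(|a|,|b|)=1$. The subgroup of $G$ generated by all $\gamma_j^*$-commutators is denoted by $\gamma_j^*(G)$. The function $f$ expresses that the order of $\Delta$ is ''$m$-bounded'', i.e. bounded by a function of $m$ only (independent of $j$ and $G$). *)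

(* Defs.v *)
From mathcomp Require Import all_boot all_fingroup all_solvable.

Set Implicit Arguments.
Unset Strict Implicit.
Unset Printing Implicit Defensive.

Local Open Scope group_scope.

Section GammaStar.

Variable gT : finGroupType.
Implicit Types (G C : {set gT}) (j : nat).

(* The powers of c are the elements of <[c]>, and [~ a, b] = a^-1 * a ^ b,   *)
(* that is a^-1 * b^-1 * a * b.                                              *)
Definition gamma_star_step G C : {set gT} :=
  [set [~ a, b] | a in \bigcup_(c in C) <[c]>, b in G & coprime #[a] #[b]].

(* Indices start at j = 1; the value at j = 0 is junk, equal to that at 1.   *)
Definition gamma_star_comm j G : {set gT} := iter j.-1 (gamma_star_step G) G.

Definition gamma_star j G : {set gT} := <<gamma_star_comm j G>>.

Canonical gamma_star_group j G := [group of gamma_star j G].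

End GammaStar.

(* Main.v *)
Require Import Defs.
From mathcomp Require Import all_boot all_fingroup all_solvable.

(** Write X for the set of gamma_j^*-commutators of G, K for the subgroup
    generated by X, and n for m!.  The hypothesis on G is used through
    pigeonhole (covered_pigeonhole): every sequence of elements of X has two
    terms, with indices differing by a divisor of n, in a common cyclic subgroup.
    As X is invariant under conjugation, this has three consequences:
    - the sequence x ^ (g ^ t) shows that g ^ n normalises <[x]>, for every x
      in X and g in G (expg_fact_norm_cycle);
    - the sequence x ^ (a ^ t), with a in an abelian normal subgroup, shows that
      x commutes with [x, a ^ n] (commute_comm_exp);
    - an abelian subgroup contained in X has all its n-th powers in a single
      cyclic subgroup (covered_abelian_exp).
    All orders are bounded by Dietzmann's lemma: if the elements of X have order
    dividing s modulo a normal subgroup N, then at most m * s cosets of N meet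
    X, and so K / N has bounded order (gamma_star_quotient_bound).

    When K is abelian, the n-th powers of the elements of K form a cyclic group
    (abelian_gamma_star_cyclic).  For j > 1 this is shown for one prime p at a
    time.  The set [P, y], where P is the Sylow p-subgroup of K and y a
    p'-element of G, is a subgroup contained in X, so that [P, y] ^ n is cyclic.
    The group G acts on P as a nilpotent group, because K, which is abelian and
    contains P, acts trivially and a group without nontrivial
    gamma_j^*-commutators is nilpotent.  Let B = P ^ n.  If some p'-element acts
    nontrivially on B, then there is one, h, whose action is moreover central in
    the group induced on B.  It splits B into the normal subgroups [B, h] and
    C_B(h), and no p'-element can act nontrivially on C_B(h) without producing a
    noncyclic [B, y].  So all the [B, y] lie in the cyclic group U = [B, h].
    Modulo the elements whose n-th power is in U, the p-part of K is centralised
    by all p'-elements, and then a commutator of elements of coprime orders has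
    trivial p-part.

    Next, the derived subgroup K' has bounded order.  Let M_e be generated by the
    e-th powers of the elements of X.  If M_e is abelian, then for x in X and
    b in M_e ^ n the element x commutes with [x, b], whence
    [x, b ^ e] = [x ^ e, b] = 1; so K has a centre of bounded index, and K' is
    bounded by Schur's theorem (abelian_power_group_der1_bound).  In general
    M = M_n normalises every <[x]>, so M' centralises K.  The abelian case
    applied to G / M' bounds |K' : M'|, and the preceding paragraph applied to
    G / K' shows that M modulo its intersection with K' is cyclic.  Hence M has
    an abelian subgroup that contains the q-th powers of all elements of M, with
    q bounded, and M_(nq) is abelian: the abelian case applies to G itself.

    Finally Delta is the preimage in K of the kernel of a |-> a ^ n on K / K'.
    Its order is |K'| |K / K' : (K / K') ^ n|, and K / Delta is isomorphic to the
    cyclic group (K / K') ^ n. *)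

Set Implicit Arguments.
Unset Strict Implicit.
Unset Printing Implicit Defensive.

Local Open Scope group_scope.

(** * Bounds for finite groups: Dietzmann and Schur *)

Lemma leq_wexp2r e m n : m <= n -> m ^ e <= n ^ e.
Proof. by move=> le; elim: e => // e IHe; rewrite !expnS leq_mul. Qed.

Section Dietzmann.
Variable gT : finGroupType.
Implicit Types (X : {set gT}) (w : seq gT).

Let prods w := \prod_(y <- w) y.

(** All the occurrences of x can be moved to the front of a word over X: moving
    x past y replaces y by a conjugate, which is again in X. *)
Lemma gather_word X x w :
    x \in X -> {in X &, forall y z, y ^ z \in X} -> all (mem X) w ->
  exists2 w', all (mem X) w' &
    size w = size w' + count_mem x w /\ prods w = x ^+ count_mem x w * prods w'.
Proof.
move=> Xx nX; elim: w => [_|y w IH /= /andP[Xy /IH[w' Xw' [sw pw]]]].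
  by exists [::]; rewrite // /prods !big_nil mulg1.
rewrite /prods big_cons -/(prods w) pw; rewrite /=.
have [->|neq] := eqVneq y x.
  by exists w' => //=; rewrite sw add1n addnS expgS mulgA.
exists (y ^ (x ^+ count_mem x w) :: w') => /=; last first.
  by rewrite sw add0n addSn /prods big_cons mulgA (conjgC y) -mulgA.
rewrite Xw' andbT; elim: (count_mem x w) => [|c IHc]; first by rewrite conjg1.
by rewrite expgSr conjgM nX.
Qed.

(** A word in which some letter x occurs at least s times can be shortened: gather
    the occurrences of x and cancel x ^ s.  So every element of the group is
    given by a word of length at most #|X| * s. *)
Lemma Dietzmann X s :
    0 < s -> {in X &, forall x y, x ^ y \in X} ->
    {in X, forall x, x ^+ s = 1} ->
  #|<<X>>| <= #|X|.+1 ^ (#|X| * s).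
Proof.
move=> s_gt0 nX Xs.
have shorten w : all (mem X) w -> #|X| * s < size w ->
  exists2 w', all (mem X) w' & size w' < size w /\ prods w' = prods w.
  move=> Xw lt_w.
  have [x Xx cx]: exists2 x, x \in X & s <= count_mem x w.
    apply/exists_inP; apply: contraLR lt_w => /exists_inPn small.
    rewrite -leqNgt -sum_nat_const.
    have ->: size w = \sum_(x in X) count_mem x w.
      elim: w Xw {small} => [_|y w IH /= /andP[Xy Xw]].
        by rewrite big1.
      rewrite big_split -(IH Xw) /= (bigD1 y) //= eqxx big1 ?addn0 ?add1n //.
      by move=> x /andP[_ /negPf neq]; rewrite eq_sym neq.
    by apply: leq_sum => x Xx; rewrite ltnW // ltnNge small.
  have [w' Xw' [sw pw]] := gather_word Xx nX Xw.
  exists (nseq (count_mem x w - s) x ++ w').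
    by rewrite all_cat Xw' andbT all_nseq /= Xx orbT.
  rewrite size_cat size_nseq sw; split.
    by rewrite addnC ltn_add2l -subn_gt0 subKn.
  rewrite pw /prods big_cat big_nseq /=; congr (_ * _).
  rewrite -[in RHS](subnK cx) expgD Xs // mulg1.
  by elim: (_ - _) => //= d ->; rewrite expgS.
have word g : g \in <<X>> ->
    exists w, [/\ all (mem X) w, size w <= #|X| * s & g = prods w].
  case/gen_prodgP=> l [c Xc ->].
  have: exists w, [/\ all (mem X) w & \prod_i c i = prods w].
    exists [seq c i | i <- index_enum 'I_l]; split.
      by apply/allP=> _ /mapP[i _ ->]; apply: Xc.
    by rewrite /prods big_map.
  case=> w; have [k] := ubnP (size w).
  elim: k w => // k IH w lt_w [Xw def_g].
  have [le_w | lt_sw] := leqP (size w) (#|X| * s); first by exists w.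
  have [w' Xw' [lt_w' eqw]] := shorten w Xw lt_sw.
  by apply: (IH w'); rewrite ?eqw // (leq_trans lt_w').
set t := (#|X| * s)%N in word *.
(* Words of length at most t are padded to length t with the letter None. *)
pose eval (f : {ffun 'I_t -> option gT}) := \prod_i odflt 1 (f i).
pose oX := None |: Some @: X.
have sub: <<X>> \subset eval @: (ffun_on (mem oX)).
  apply/subsetP=> g /word[w [Xw sw ->]].
  pose ow i := if i < size w then Some (nth 1 w i) else None.
  apply/imsetP; exists [ffun i : 'I_t => ow i].
    apply/ffun_onP=> i; rewrite ffunE /ow; case: ifP => [lt|_]; last exact: setU11.
    by apply/setU1r/imset_f/(allP Xw)/mem_nth.
  rewrite /eval /prods (big_nth 1) big_mkord.
  rewrite (big_ord_widen _ (fun i => nth 1 w i) sw) big_mkcond.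
  by apply: eq_bigr => i _; rewrite ffunE /ow; case: ifP.
apply: leq_trans (subset_leq_card sub) (leq_trans (leq_imset_card _ _) _).
rewrite card_ffun_on card_ord leq_wexp2r //.
by rewrite cardsU1 -add1n leq_add ?leq_b1 ?leq_imset_card.
Qed.
End Dietzmann.

Section Schur.
Variable gT : finGroupType.
Implicit Types K Z : {group gT}.

(** The transfer of K into the central subgroup Z kills the derived subgroup and
    sends c in Z to c ^ #|K : Z|. *)
Lemma der1_central_exp K Z c :
  Z \subset 'Z(K) -> c \in K^`(1) -> c \in Z -> c ^+ #|K : Z| = 1.
Proof.
move=> sZ K'c Zc; have [sZK cKZ] := subsetIP sZ.
have abZ: abelian (idm Z @* Z).
  by rewrite morphim_idm // (abelianS sZ) ?center_abelian.
pose tr := transfer_morphism K abZ.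
have: c \in 'ker tr.
  apply: subsetP K'c; rewrite gen_subG.
  apply/subsetP=> _ /imset2P[x y Kx Ky ->].
  rewrite mem_morphpre ?groupR // inE morphR //.
  by apply/commgP; apply: FiniteModule.fmod_addrC.
move/mker=> /=; rewrite /transfer.
rewrite (eq_bigr (fun _ => FiniteModule.fmod abZ c)) => [|_ /rcosetsP[x Kx ->]].
  rewrite ssralg.GRing.sumr_const => /(congr1 FiniteModule.fmval).
  by rewrite FiniteModule.fmvalZ FiniteModule.fmodK //= morphim_idm.
have cxc: c * x = x * c by apply: (centP (subsetP cKZ c Zc)).
rewrite -rcosetM -cxc rcosetM (rcoset_id Zc) /=.
congr FiniteModule.fmod.
rewrite -(centP (subsetP cKZ c Zc)) ?mulgK //.
by case: repr_rcosetP => z Zz; rewrite groupM // (subsetP sZK).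
Qed.

Lemma expg_indexg K Z x : Z <| K -> x \in K -> x ^+ #|K : Z| \in Z.
Proof.
move=> nZK Kx; have nZx := subsetP (normal_norm nZK) x Kx.
apply: coset_idr; rewrite ?groupX // morphX // -card_quotient ?normal_norm //.
by rewrite expg_cardG ?mem_quotient.
Qed.

(** Schur's theorem.  The commutator [a, b] depends only on the cosets of a and b
    modulo Z, so there are at most k ^ 2 commutators; each has order dividing
    #|K : Z| ^ 2, by the transfer, and Dietzmann's lemma applies. *)
Lemma Schur_bound K Z k :
  Z \subset 'Z(K) -> #|K : Z| <= k ->
  #|K^`(1)| <= (k ^ 2).+1 ^ (k ^ 2 * k ^ 2).
Proof.
move=> sZ le_k; have [sZK cKZ] := subsetIP sZ.
have nZK: Z <| K by apply: sub_center_normal.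
pose S := commg_set K K; pose i := #|K : Z|.
have i_gt0: 0 < i by apply: indexg_gt0.
have cardS: #|S| <= i ^ 2.
  pose rep x := repr (Z :* x).
  have repE x : x \in K -> exists2 z, z \in Z & x = z * rep x.
    move=> Kx; rewrite /rep; case: repr_rcosetP => z Zz.
    by exists z^-1; rewrite ?groupV // mulKg.
  pose R := [set rep x | x in K].
  have cardR: #|R| <= i.
    rewrite /i /indexg /R (_ : rep @: K = repr @: rcosets Z K) ?leq_imset_card //.
    by rewrite /rcosets -imset_comp; apply: eq_imset => x /=; rewrite rcosetE.
  have cZ z y : z \in Z -> y \in K -> [~ z, y] = 1.
    by move=> Zz Ky; apply/eqP/commgP/(centP (subsetP cKZ z Zz)).
  have sSR: S \subset [set [~ u.1, u.2] | u in setX R R].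
    apply/subsetP=> _ /imset2P[a b Ka Kb ->].
    apply/imsetP; exists (rep a, rep b); first by rewrite in_setX !(imset_f rep).
    have [[z Zz def_a] [t Zt def_b]] := (repE a Ka, repE b Kb).
    have Kra: rep a \in K.
      by rewrite -(groupMl _ (subsetP sZK z Zz)) -def_a.
    rewrite /= {1}def_a commMgJ (cZ z) // conj1g mul1g {1}def_b commgMJ.
    by rewrite -[[~ rep a, t]]invgK invg_comm (cZ t) // invg1 conj1g mulg1.
  apply: leq_trans (subset_leq_card sSR) (leq_trans (leq_imset_card _ _) _).
  by rewrite cardsX leq_mul.
have exS x : x \in S -> x ^+ (i ^ 2) = 1.
  move=> Sx; have K'x: x \in K^`(1) by apply: mem_gen.
  rewrite expnS expn1 expgM; apply: (der1_central_exp sZ); first exact: groupX.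
  by apply: expg_indexg; rewrite // (subsetP (der_sub 1 K)).
have nS: {in S &, forall x y, x ^ y \in S}.
  move=> _ y /imset2P[a b Ka Kb ->] Sy.
  have Ky: y \in K by rewrite (subsetP (der_sub 1 K)) // mem_gen.
  by rewrite conjRg imset2_f ?memJ_norm ?(subsetP (normG K)).
apply: leq_trans (Dietzmann _ nS exS) _; first by rewrite expn_gt0 i_gt0.
have le2: i ^ 2 <= k ^ 2 by rewrite leq_exp2r.
apply: (@leq_trans ((k ^ 2).+1 ^ (#|S| * i ^ 2))).
  by rewrite leq_wexp2r // ltnS (leq_trans cardS).
by rewrite leq_pexp2l // leq_mul // (leq_trans cardS).
Qed.
End Schur.

(** * Coverings by cyclic subgroups *)

Section Covering.

Variable gT : finGroupType.
Implicit Types (X Y : {set gT}) (A C : {group gT}) (m : nat).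

Definition covered m X :=
  exists2 C : 'I_m -> {group gT},
    forall i, cyclic (C i) & X \subset \bigcup_(i < m) C i.

Lemma coveredS m X Y : X \subset Y -> covered m Y -> covered m X.
Proof. by move=> sXY [C cC sYC]; exists C; rewrite // (subset_trans sXY). Qed.

(** The indices of the two terms that share a cyclic subgroup can be taken in
    0, ..., m; their difference is then at most m and divides m!. *)
Lemma covered_pigeonhole m X (f : nat -> gT) :
    covered m X -> (forall t, f t \in X) ->
  exists t d (C : {group gT}),
    [/\ d %| m`!, cyclic C, f t \in C & f (t + d)%N \in C].
Proof.
case=> C cycC sXC Xf.
have exC (t : 'I_m.+1) : exists i, f t \in C i.
  by have /bigcupP[i _ Ci] := subsetP sXC _ (Xf t); exists i.
pose h t := xchoose (exC t).
have: ~~ injectiveb h.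
  apply/negP=> /injectiveP/leq_card; by rewrite !card_ord ltnn.
case/injectivePn=> t [t' neq eqh].
wlog lt_t: t t' neq eqh / t < t'.
  move=> IH; have [|/IH|eqt] := ltngtP t t'; first exact: IH.
    by apply; rewrite 1?eq_sym.
  by case/eqP: neq; apply: val_inj.
exists t, (t' - t)%N, (C (h t)); split=> //; last 2 first.
- exact: xchooseP (exC t).
- by rewrite subnKC 1?ltnW // eqh; apply: xchooseP (exC t').
by rewrite dvdn_fact // subn_gt0 lt_t leq_subLR (leq_trans (leq_ord t')) ?leq_addl.
Qed.

(** By counting, one of the covering subgroups meets A in a subgroup of index at
    most m. *)
Lemma covered_abelian_exp m A :
    abelian A -> covered m A ->
  exists2 C : {group gT}, cyclic C & {in A, forall a, a ^+ m`! \in C}.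
Proof.
move=> abA [C cycC sAC].
have [i le_m]: exists i, #|A| <= m * #|A :&: C i|.
  apply/existsP; apply: contraTT sAC => /existsPn small; apply/negP=> sAC.
  have m_gt0: 0 < m.
    case: (m) C cycC sAC {small} => // C _; rewrite big_ord0 subset0.
    by move/eqP/setP/(_ 1); rewrite group1 inE.
  have: m * #|A| <= \sum_(i < m) m * #|A :&: C i|.
    rewrite -big_distrr leq_mul //.
    have ->: #|A| = #|\bigcup_(i < m) (A :&: C i)|.
      by rewrite -big_distrr /= (setIidPl sAC).
    elim/big_rec2: _ => [|i k X _ le]; first by rewrite cards0.
    by rewrite (leq_trans (leq_card_setU _ _)) // leq_add2l.
  apply/negP; rewrite -ltnNge -[m in (m * #|A|)%N]card_ord -sum_nat_const.
  apply: (@leq_trans (\sum_(i < m) (m * #|A :&: C i| + 1)%N)).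
    by rewrite big_split sum_nat_const card_ord /= muln1 -[X in X < _]addn0 ltn_add2l.
  by apply: leq_sum => i _; rewrite addn1 ltnNge small.
exists (C i) => // a Aa; have sIA: A :&: C i \subset A := subsetIl A (C i).
have ind_dvd: #|A : A :&: C i| %| m`!.
  by rewrite dvdn_fact // indexg_gt0 -divgS // leq_divLR ?cardSg.
rewrite -(divnK ind_dvd) mulnC expgM groupX //.
have: a ^+ #|A : A :&: C i| \in A :&: C i.
  by apply: expg_indexg; rewrite // -sub_abelian_normal.
by case/setIP.
Qed.

End Covering.

Lemma quotient_covered (gT : finGroupType) m (X : {set gT}) (N : {group gT}) :
  covered m X -> covered m (X / N).
Proof.
case=> C cycC sXC; exists (fun i => (C i / N)%G) => [i|].
  exact: quotient_cyclic.
apply/subsetP=> _ /morphimP[x Nx Xx ->].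
have /bigcupP[i _ Cx] := subsetP sXC x Xx.
by apply/bigcupP; exists i => //; apply: mem_morphim.
Qed.

(** * Basic properties of coprime commutators *)

Section GammaStar.
Variable gT : finGroupType.
Implicit Types (G H A N : {group gT}) (j : nat).

Lemma gamma_star_commP j G g :
  reflect (exists c a b, [/\ c \in gamma_star_comm j.+1 G, a \in <[c]>,
                             b \in G, coprime #[a] #[b] & g = [~ a, b]])
          (g \in gamma_star_comm j.+2 G).
Proof.
apply: (iffP imset2P) => [[a b /bigcupP[c Xc ac]] | [c [a [b [Xc ac Gb co ->]]]]].
  by rewrite inE => /andP[Gb co] ->; exists c, a, b.
by exists a b; rewrite ?inE ?Gb //; apply/bigcupP; exists c.
Qed.

Lemma gamma_star_comm_sub j G : gamma_star_comm j G \subset G.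
Proof.
case: j => [|j]; first exact: subxx.
elim: j => [|j IH]; first exact: subxx.
apply/subsetP=> _ /gamma_star_commP[c [a [b [Xc ac Gb _ ->]]]].
by rewrite groupR // (subsetP _ a ac) // cycle_subG (subsetP IH).
Qed.

Lemma gamma_star_sub j G : gamma_star j G \subset G.
Proof. by rewrite gen_subG gamma_star_comm_sub. Qed.

Lemma gamma_star_commJ j G x g :
  x \in gamma_star_comm j G -> g \in 'N(G) -> x ^ g \in gamma_star_comm j G.
Proof.
case: j => [|j]; first by move=> Gx nGg; rewrite memJ_norm.
elim: j x => [|j IH] x; first by move=> Gx nGg; rewrite memJ_norm.
case/gamma_star_commP=> c [a [b [Xc ac Gb co ->]]] nGg.
apply/gamma_star_commP; exists (c ^ g), (a ^ g), (b ^ g).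
by rewrite IH // cycleJ !memJ_conjg memJ_norm // !orderJ conjRg.
Qed.

Lemma gamma_star_normal j G : gamma_star j G <| G.
Proof.
rewrite /normal gamma_star_sub norms_gen //; apply/subsetP=> g Gg.
rewrite inE; apply/subsetP=> _ /imsetP[x Xx ->].
by rewrite gamma_star_commJ // (subsetP (normG G)).
Qed.

End GammaStar.

Section Quotient.
Variable gT : finGroupType.
Implicit Types (G N : {group gT}) (j : nat).

(** The delicate inclusion lifts commutators from G / N.  Representatives of two
    elements a', b' of coprime orders need not have coprime orders, but this is
    repaired by keeping only the pi-part of one and the pi'-part of the other,
    where pi is the set of prime divisors of #[a'].  The pi-part is still a
    power of a gamma_(j-1)^*-commutator. *)
Lemma quotient_gamma_star_comm j G N :
  G \subset 'N(N) -> gamma_star_comm j (G / N) = gamma_star_comm j G / N.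
Proof.
move=> nNG; case: j => // j; elim: j => // j IH.
have nN := subsetP nNG.
have nX := subset_trans (gamma_star_comm_sub _ G) nNG.
apply/setP=> y; apply/idP/idP.
  case/gamma_star_commP=> c' [a' [b' [Xc' ac' Gb' co ->]]].
  move: Xc'; rewrite /= IH => /morphimP[c Nc Xc def_c].
  have [k def_a] := cycleP _ _ ac'.
  have [b Nb Gb def_b] := morphimP Gb'.
  pose pi : nat_pred := \pi(#[a']).
  pose a := (c ^+ k).`_pi; pose b1 := b.`_pi^'.
  have Na: a \in 'N(N) by rewrite /a /constt !groupX.
  have Nb1: b1 \in 'N(N) by rewrite /b1 /constt !groupX.
  have eq_a: coset N a = a'.
    rewrite morph_constt ?groupX // morphX // -def_c -def_a.
    by rewrite constt_p_elt // /p_elt pnat_pi ?order_gt0.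
  have eq_b: coset N b1 = b'.
    rewrite morph_constt // -def_b constt_p_elt // /p_elt.
    by rewrite -coprime_pi' ?order_gt0.
  rewrite -eq_a -eq_b -morphR //; apply: mem_morphim; first exact: groupR.
  apply/gamma_star_commP; exists c, a, b1; split=> //.
  - by rewrite /a /constt !groupX ?cycle_id.
  - by rewrite /b1 /constt groupX.
  by apply: (pnat_coprime (p_elt_constt _ _) (p_elt_constt _ _)).
case/morphimP=> g Ng /gamma_star_commP[c [a [b [Xc ac Gb co ->]]]] -> /=.
have Nc: c \in 'N(N) by apply: (subsetP (nX j.+1)).
have Na: a \in 'N(N) by apply: subsetP ac; rewrite cycle_subG.
apply/gamma_star_commP; exists (coset N c), (coset N a), (coset N b).
split.
- by rewrite IH; apply: mem_morphim.
- by rewrite -quotient_cycle // mem_quotient.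
- exact: mem_quotient.
- apply: coprime_dvdl (morph_order _ Na) _.
  by apply: coprime_dvdr (morph_order _ (nN b Gb)) co.
by rewrite morphR // nN.
Qed.

Lemma quotient_gamma_star j G N :
  G \subset 'N(N) -> gamma_star j (G / N) = gamma_star j G / N.
Proof.
move=> nNG; rewrite /gamma_star quotient_gamma_star_comm // quotient_gen //.
exact: subset_trans (gamma_star_comm_sub _ G) nNG.
Qed.

End Quotient.

(** * Powers of covered coprime commutators *)

Lemma card_Ldiv_cyclic (gT : finGroupType) (C : {group gT}) s :
  0 < s -> cyclic C -> #|'Ldiv_s(C)| <= s.
Proof.
move=> s_gt0 cycC; pose H := Group (group_Ldiv s (cyclic_abelian cycC)).
have /cyclicP[u defH]: cyclic H by apply: cyclicS (cycC); apply: subsetIl.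
have/LdivP[_ us]: u \in 'Ldiv_s(C) by rewrite -[_ :&: _]/(gval H) defH cycle_id.
rewrite -[_ :&: _]/(gval H) defH -orderE.
by rewrite dvdn_leq // order_dvdn us.
Qed.

Definition dietzmann_bound m s := ((m * s).+1 ^ (m * s * s))%N.
Definition schur_bound k := ((k ^ 2).+1 ^ (k ^ 2 * k ^ 2))%N.

Lemma covered_torsion_bound (gT : finGroupType) m s (X : {set gT}) :
    covered m X -> 0 < s -> {in X &, forall x y, x ^ y \in X} ->
    {in X, forall x, x ^+ s = 1} ->
  #|<<X>>| <= dietzmann_bound m s.
Proof.
move=> [C cycC sXC] s_gt0 nX Xs; apply: leq_trans (Dietzmann s_gt0 nX Xs) _.
have leX: #|X| <= m * s.
  have sX: X \subset \bigcup_(i < m) 'Ldiv_s(C i).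
    apply/subsetP=> x Xx; have /bigcupP[i _ Cx] := subsetP sXC x Xx.
    by apply/bigcupP; exists i => //; apply/LdivP; rewrite Xs.
  apply: leq_trans (subset_leq_card sX) _.
  rewrite -[m in (m * s)%N]card_ord -sum_nat_const.
  elim/big_rec2: _ => [|i k Y _ le]; first by rewrite cards0.
  by rewrite (leq_trans (leq_card_setU _ _)) // leq_add ?card_Ldiv_cyclic.
apply: leq_trans (leq_wexp2r _ (_ : _ <= (m * s).+1)) _; first by [].
by rewrite leq_pexp2l // leq_mul2r leX orbT.
Qed.

Section CoveredGammaStar.

Variables (gT : finGroupType) (G : {group gT}) (j m : nat).
Implicit Types (A M Z : {group gT}) (x y a g : gT).
Local Notation X := (gamma_star_comm j G).
Local Notation K := (gamma_star j G).
Local Notation n := (m`!).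
Hypothesis covX : covered m X.

(** Among the conjugates x ^ (g ^ t) two lie in the same cyclic group; having the
    same order they generate the same subgroup. *)
Lemma expg_fact_norm_cycle x g : x \in X -> g \in G -> g ^+ n \in 'N(<[x]>).
Proof.
move=> Xx Gg; pose f t := x ^ (g ^+ t).
have Xf t : f t \in X.
  by rewrite gamma_star_commJ // groupX // (subsetP (normG G)).
have [t [d [C [/dvdnP[q ->] cycC Cft Cftd]]]] := covered_pigeonhole covX Xf.
rewrite mulnC expgM groupX //.
have eq_cyc: <[f t]> = <[f (t + d)%N]>.
  apply/eqP; rewrite (eq_subG_cyclic cycC) ?cycle_subG //.
  by rewrite -!orderE !orderJ.
apply/normP; apply: (can_inj (conjsgK (g ^+ t))) => /=.
by rewrite -conjsgM -expgD -!cycleJ addnC -eq_cyc.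
Qed.

(** Among the conjugates x ^ (a ^ t) two commute, so that x commutes with some
    x ^ (a ^ d) = x * [x, a] ^ d, where d divides n. *)
Lemma commute_comm_exp A x a :
  A <| G -> abelian A -> x \in X -> a \in A -> commute x [~ x, a ^+ n].
Proof.
move=> nAG abA Xx Aa; have [sAG nAG'] := andP nAG.
have Gx := subsetP (gamma_star_comm_sub j G) x Xx.
have Gat t : a ^+ t \in G by rewrite groupX // (subsetP sAG).
have Ac k : [~ x, a ^+ k] \in A.
  by rewrite commgEr groupMl ?groupX // memJ_norm ?groupV ?groupX // (subsetP nAG').
have Xf t : x ^ (a ^+ t) \in X.
  by rewrite gamma_star_commJ // (subsetP (normG G)).
have [t [d [C [/dvdnP[q ->] cycC Cft Cftd]]]] := covered_pigeonhole covX Xf.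
have cax k : commute a [~ x, a ^+ k].
  by apply: (centsP abA).
have cxd: commute x [~ x, a ^+ d].
  have cx: commute x (x ^ (a ^+ d)).
    apply: (conjg_inj (a ^+ t)); rewrite (conjMg x) (conjMg _ x).
    rewrite -[in LHS]conjgM -[in RHS]conjgM -expgD addnC.
    exact: centsP (cyclic_abelian cycC) _ Cft _ Cftd.
  by rewrite commgEl; apply: commuteM cx; apply/commuteV.
rewrite mulnC expgM commgX; first exact: commuteX.
by apply: (centsP abA); rewrite ?groupX.
Qed.

Lemma cent_gamma_star : 'C(K) = 'C(X).
Proof. exact: cent_gen. Qed.

Definition power_group e := <<[set x ^+ e | x in X]>>%G.

Lemma power_groupP e x : x \in X -> x ^+ e \in power_group e.
Proof. by move=> Xx; apply/mem_gen/imset_f. Qed.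

Lemma power_group_sub_gamma e : power_group e \subset K.
Proof.
by rewrite gen_subG; apply/subsetP=> _ /imsetP[x Xx ->]; rewrite groupX ?mem_gen.
Qed.

Lemma power_group_norm e : G \subset 'N(power_group e).
Proof.
rewrite norms_gen //; apply/subsetP=> g Gg; rewrite inE.
apply/subsetP=> _ /imsetP[_ /imsetP[x Xx ->] ->].
by rewrite conjXg; apply/imset_f/gamma_star_commJ; rewrite ?(subsetP (normG G)).
Qed.

Lemma power_group_normal e : power_group e <| G.
Proof.
rewrite /normal power_group_norm andbT.
exact: subset_trans (power_group_sub_gamma e) (gamma_star_sub j G).
Qed.

(** For b in M ^ n, where M is the abelian group generated by the e-th powers, x
    commutes with [x, b], and b does too.  Hence [x, b ^ e] = [x, b] ^ e =
    [x ^ e, b], which is trivial since x ^ e and b are both in M. *)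
Lemma abelian_power_group_central e :
    abelian (power_group e) ->
  power_group (e * n * e) \subset 'Z(K).
Proof.
move=> abM; rewrite subsetI power_group_sub_gamma cent_gamma_star gen_subG.
apply/subsetP=> _ /imsetP[y Xy ->]; apply/centP=> x Xx.
apply/commute_sym/commgP/eqP; have My := power_groupP e Xy.
set b := (y ^+ e) ^+ n; have Mb: b \in power_group e by rewrite groupX.
have cxb: commute x [~ x, b].
  exact: (commute_comm_exp (power_group_normal e)).
have Gx := subsetP (gamma_star_comm_sub j G) x Xx.
have cbx: commute b [~ x, b].
  apply: (centsP abM) => //; rewrite commgEr groupM // memJ_norm ?groupV //.
  exact: subsetP (power_group_norm e) x Gx.
rewrite !expgM -/b commgX // -commXg //; apply/eqP/commgP.
by apply: (centsP abM); rewrite ?power_groupP.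
Qed.

(** This is the form in which Dietzmann's lemma is used: a cyclic group has at
    most s elements of order dividing s, so the image of X has at most m * s
    elements. *)
Lemma gamma_star_quotient_bound s (N : {group gT}) :
    G \subset 'N(N) -> 0 < s -> {in X, forall x, x ^+ s \in N} ->
  #|K / N| <= dietzmann_bound m s.
Proof.
move=> nNG s_gt0 Xs; have sXN := subset_trans (gamma_star_comm_sub j G) nNG.
rewrite /gamma_star quotient_gen //.
apply: covered_torsion_bound => // [||_ /morphimP[x Nx Xx ->]].
- exact: quotient_covered.
- move=> _ _ /morphimP[x Nx Xx ->] /morphimP[y Ny Xy ->].
  rewrite -morphJ // mem_morphim ?groupJ // gamma_star_commJ //.
  by rewrite (subsetP (normG G)) // (subsetP (gamma_star_comm_sub j G)).
by rewrite -morphX //; apply: coset_id; apply: Xs.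
Qed.

(** The group of (e * n * e)-th powers is central and of bounded index in K. *)
Lemma abelian_power_group_der1_bound e :
    0 < e -> abelian (power_group e) ->
  #|K^`(1)| <= schur_bound (dietzmann_bound m (e * n * e)).
Proof.
move=> e_gt0 abM; set s := (e * n * e)%N.
have sZ: power_group s \subset 'Z(K) := abelian_power_group_central abM.
apply: (Schur_bound sZ) => /=.
rewrite -/(power_group s) -card_quotient; last first.
  exact: subset_trans (gamma_star_sub j G) (power_group_norm s).
apply: (gamma_star_quotient_bound ) => [||x].
- exact: power_group_norm.
- by rewrite !muln_gt0 e_gt0 fact_gt0.
exact: power_groupP.
Qed.

End CoveredGammaStar.

(** * Groups without nontrivial coprime commutators *)

Section Generic.
Variable gT : finGroupType.
Implicit Types (G A : {group gT}) (a b g w : gT) (p q : nat).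

Lemma coprime_p'_elt p a b :
  prime p -> coprime #[a] #[b] -> ~~ p^'.-elt b -> p^'.-elt a.
Proof.
move=> p_pr co; rewrite /p_elt !p'natE // => /negbNE p_b.
by rewrite -prime_coprime // (coprime_dvdl p_b) // coprime_sym.
Qed.

(** If w = [a, b] commutes with the p'-element a, then a ^ b = a * w has the same
    order as a, so the order of the p-element w divides that of a. *)
Lemma commg_p_elt1 p a b :
    p.-elt [~ a, b] ->
    (p^'.-elt a /\ commute [~ a, b] a) \/ (p^'.-elt b /\ commute [~ a, b] b) ->
  [~ a, b] = 1.
Proof.
have key (x y : gT) : p.-elt [~ x, y] -> p^'.-elt x -> commute [~ x, y] x ->
  [~ x, y] = 1.
- move=> p_w p'x cwx; apply/eqP; rewrite -order_eq1 -dvdn1.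
  rewrite -(eqnP (pnat_coprime p_w p'x)) dvdn_gcd dvdnn order_dvdn.
  have: (x ^ y) ^+ #[x] = 1 by rewrite -conjXg expg_order conj1g.
  rewrite conjg_mulR expgMn 1?expg_order ?mul1g => [->|]; first by rewrite eqxx.
  exact: commute_sym.
move=> p_w [[p'a cwa] | [p'b cwb]]; first exact: key.
apply: invg_inj; rewrite invg1 invg_comm; apply: key => //.
  by rewrite -invg_comm /p_elt orderV.
by rewrite -invg_comm; apply/commute_sym/commuteV/commute_sym.
Qed.

(** The index of the centraliser of g is a power of q, so a Sylow q-subgroup S
    containing g acts transitively on the conjugates of g, all of which
    are then in S. *)
Lemma cent_p'_elt_pcore q G g :
    g \in G -> q.-elt g -> {in G, forall b, q^'.-elt b -> commute g b} ->
  g \in 'O_q(G).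
Proof.
move=> Gg q_g cg.
have [S sylS sgS] : {S : {group gT} | q.-Sylow(G) S & <[g]> \subset S}.
  by apply: Sylow_superset; rewrite ?cycle_subG.
have sSG := pHall_sub sylS.
pose C := 'C_G[g]%G.
have qC: q.-nat #|G : C|.
  apply/pnatP=> // r r_pr r_dv; apply: contraLR r_dv => qr.
  have [R sylR] := Sylow_exists r G.
  have sRC: R \subset C.
    rewrite subsetI (pHall_sub sylR); apply/subsetP=> b Rb; apply/cent1P.
    apply: commute_sym; apply: cg; first exact: subsetP (pHall_sub sylR) b Rb.
    apply: sub_in_pnat (mem_p_elt (pHall_pgroup sylR) Rb) => t _.
    by rewrite !inE => /eqP->.
  have r'GR: r^'.-nat #|G : R| by case/and3P: sylR.
  rewrite -p'natE // (pnat_dvd _ r'GR) // -(Lagrange_index (subsetIl _ _) sRC).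
  exact: dvdn_mulr.
have defG: C * S = G.
  apply: coprime_index_mulG => //; first exact: subsetIl.
  by apply: pnat_coprime qC _; case/and3P: sylS.
have sgG: g ^: G \subset S.
  apply/subsetP=> _ /imsetP[y Gy ->].
  move: Gy; rewrite -defG => /mulsgP[c s /setIP[_ /cent1P cgc] Ss ->].
  have gc: g ^ c = g by apply/conjg_fixP/commgP/commute_sym.
  rewrite conjgM gc.
  by rewrite groupJ // -cycle_subG.
have: <<g ^: G>> \subset 'O_q(G).
  apply: pcore_max; first by apply: pgroupS (pHall_pgroup sylS); rewrite gen_subG.
  by rewrite /normal gen_subG norms_gen ?class_norm ?class_subG.
by move/subsetP; apply; apply/mem_gen/class_refl.
Qed.

End Generic.

(** If the gamma_(k+1)^*-commutators are trivial, the q-part of a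
    gamma_k^*-commutator c commutes with all q'-elements, and so is in O_q(G).
    For k = 1 this says that G is its own Fitting subgroup.  For k > 1, modulo
    O_(q')(G) the commutator c = [a, b] is a q-element that commutes with
    whichever of a and b has order prime to q, and is trivial; so the
    gamma_k^*-commutators are trivial too. *)
Lemma gamma_star_trivial_nilpotent (gT : finGroupType) j (G : {group gT}) :
  gamma_star_comm j G \subset [set 1] -> nilpotent G.
Proof.
suff IH k : gamma_star_comm k.+1 G \subset [set 1] -> nilpotent G.
  by case: j => [|j]; [apply: (IH 0) | apply: IH].
elim: k => [|k IHk] triv.
  by rewrite (trivgP triv) nilpotent1.
have coreX c (q : nat) : c \in gamma_star_comm k.+1 G -> c.`_q \in 'O_q(G).
  move=> Xc; have Gc := subsetP (gamma_star_comm_sub _ _) c Xc.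
  apply: cent_p'_elt_pcore; rewrite ?p_elt_constt //.
    by rewrite /constt groupX.
  move=> b Gb q'b; apply/commgP; rewrite -in_set1 (subsetP triv) //.
  apply/gamma_star_commP; exists c, c.`_q, b; split=> //.
    exact: cycle_constt.
  exact: pnat_coprime (p_elt_constt _ _) q'b.
have fitX: {subset gamma_star_comm k.+1 G <= 'F(G)}.
  move=> c Xc; rewrite -(prod_constt c); apply: group_prod => q _.
  apply: subsetP (coreX c q Xc); apply: Fitting_max (pcore_normal _ _) _.
  exact: pgroup_nil (pcore_pgroup _ _).
case: k => [|k] in IHk triv coreX fitX *.
  by apply: nilpotentS (Fitting_nil G); apply/subsetP.
apply: IHk; apply/subsetP=> c Xc; rewrite inE -order_eq1.
have q'c q : prime q -> q^'.-elt c.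
  move=> q_pr; apply/constt1P; set N := 'O_q^'(G).
  have Nq': c.`_q^' \in N.
    have nilF := Fitting_nil G.
    have sON: 'O_q^'('F(G)) \subset N.
      apply: pcore_max (pcore_pgroup _ _) _.
      by apply: char_normal_trans (pcore_char _ _) (Fitting_normal G).
    apply: (subsetP sON); rewrite (mem_Hall_pcore (nilpotent_pcore_Hall _ nilF)).
      exact: p_elt_constt.
    by rewrite /constt groupX // fitX.
  have nNG: G \subset 'N(N) := gFnorm _ _.
  have nN := subsetP nNG.
  have Gc: c \in G := subsetP (gamma_star_comm_sub _ _) c Xc.
  have Gcq pi : c.`_pi \in G by rewrite /constt groupX.
  have eqc: coset N c = coset N c.`_q.
    by rewrite -{1}(consttC q c) morphM ?nN //= (coset_id Nq') mulg1.
  have cN b : b \in G -> q^'.-elt b -> commute (coset N c) (coset N b).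
    move=> Gb q'b; rewrite eqc /commute -!morphM ?nN //; congr (coset N _).
    apply/commgP; rewrite -in_set1 (subsetP triv) //.
    apply/gamma_star_commP; exists c, c.`_q, b; split=> //.
      exact: cycle_constt.
    exact: pnat_coprime (p_elt_constt _ _) q'b.
  have [c0 [a [b [Xc0 ac0 Gb co def_c]]]] := gamma_star_commP _ _ _ Xc.
  have Ga: a \in G.
    apply: subsetP ac0; rewrite cycle_subG.
    exact: subsetP (gamma_star_comm_sub _ _) c0 Xc0.
  have Nc: c \in N.
    apply: coset_idr; first exact: nN.
    rewrite def_c morphR ?nN //; apply: (@commg_p_elt1 _ q).
      by rewrite -morphR ?nN //= -def_c eqc morph_p_elt ?nN ?p_elt_constt.
    rewrite -morphR ?nN //= -def_c.
    have [q'b | q_b] := boolP (q^'.-elt b).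
      by right; rewrite morph_p_elt ?nN //; split=> //; apply: cN.
    have q'a := coprime_p'_elt q_pr co q_b.
    by left; rewrite morph_p_elt ?nN //; split=> //; apply: cN.
  apply/constt1P; exact: mem_p_elt (pcore_pgroup _ _) Nc.
have [lt1 | ] := ltnP 1 #[c]; last by rewrite leq_eqVlt ltnNge order_gt0 orbF.
have := q'c _ (pdiv_prime lt1).
by rewrite /p_elt p'natE ?pdiv_prime // pdiv_dvd.
Qed.

(** * Powers and commutators in an abelian group *)

Section AbelianMorphisms.

Variables (gT : finGroupType) (A : {group gT}).
Hypothesis abA : abelian A.

Lemma expgM_abelian s : {in A &, {morph (fun a => a ^+ s) : a b / a * b}}.
Proof. by move=> a b Aa Ab; apply/expgMn/(centsP abA). Qed.
Definition expg_morphism s := Morphism (expgM_abelian s).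

Variable y : gT.
Hypothesis nAy : y \in 'N(A).

Lemma commg_mem_abelian a : a \in A -> [~ a, y] \in A.
Proof. by move=> Aa; rewrite commgEl groupM ?groupV ?memJ_norm. Qed.

Lemma commgM_abelian : {in A &, {morph (fun a => [~ a, y]) : a b / a * b}}.
Proof.
move=> a b Aa Ab /=; rewrite commMgJ; congr (_ * _); apply/conjg_fixP/commgP.
by apply: (centsP abA); rewrite ?commg_mem_abelian.
Qed.
Definition commg_morphism := Morphism commgM_abelian.

Lemma commgX_abelian s : {in A, forall a, [~ a ^+ s, y] = [~ a, y] ^+ s}.
Proof. by move=> a Aa; apply: (morphX commg_morphism). Qed.

Lemma commg_im_sub : commg_morphism @* A \subset A.
Proof. by apply/subsetP=> _ /morphimP[a Aa _ ->]; apply: commg_mem_abelian. Qed.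

Lemma mem_commg_im a : a \in A -> [~ a, y] \in commg_morphism @* A.
Proof. by move=> Aa; apply: (mem_morphim commg_morphism). Qed.

Hypothesis coAy : coprime #|A| #[y].

(** Coprime action: A is the direct product of [A, y] and C_A(y). *)
Lemma commg_im_regular u : u \in commg_morphism @* A -> [~ u, y] = 1 -> u = 1.
Proof.
move=> /morphimP[a Aa _ ->] /= /eqP/commgP cuy; apply/eqP; rewrite -in_set1.
rewrite -[[set 1]](coprime_abel_cent_TI (_ : <[y]> \subset 'N(A)) coAy abA).
  rewrite inE cent_cycle mem_commg ?cycle_id //=; apply/cent1P; exact/commute_sym.
by rewrite cycle_subG.
Qed.

(** The map u |-> [u, y] is injective on the finite group [A, y] by the preceding
    lemma, hence maps it onto itself. *)
Lemma commg_im_surj a :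
  a \in A -> exists2 u, u \in commg_morphism @* A & [~ a, y] = [~ u, y].
Proof.
move=> Aa; set I := commg_morphism @* A.
have sIA: I \subset A := commg_im_sub.
have injI: {in I &, injective (fun u => [~ u, y])}.
  move=> u v Iu Iv eq_uv; apply/eqP; rewrite eq_mulgV1; apply/eqP.
  apply: commg_im_regular; first by rewrite groupM ?groupV.
  have Au := subsetP sIA u Iu; have Av := subsetP sIA v Iv.
  have /= -> := commgM_abelian Au (groupVr Av).
  have /= -> := morphV commg_morphism Av.
  by rewrite eq_uv mulgV.
have: (fun u => [~ u, y]) @: I == I.
  rewrite eqEcard (card_in_imset injI); apply/andP; split; last exact: leqnn.
  apply/subsetP=> _ /imsetP[u Iu ->]; apply: mem_commg_im.
  exact: subsetP sIA u Iu.
move/eqP=> eqI; have: [~ a, y] \in I by apply: mem_commg_im.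
by rewrite -{1}eqI => /imsetP[u Iu ->]; exists u.
Qed.

End AbelianMorphisms.

(** * The cyclic subgroup containing all commutators with p'-elements *)

(** If all p'-elements centralise B, take U = 1. Otherwise some p'-element h has
    a nontrivial action on B which is central in the group that G induces on B.
    Then U = [B, h] and T = C_B(h) are G-invariant and B is their direct
    product. If a p'-element y acts nontrivially on U, then it acts trivially on
    T, since [U, y] and [T, y] are p-subgroups of a cyclic group and intersect
    trivially. If z acts trivially on U, then the same applies to the p'-part of
    z * h, which acts on U as h and on T as z. In all cases [T, z] = 1. *)
Lemma cyclic_commutators_in_cyclic (gT : finGroupType) (p : nat) (G B : {group gT}) :
    p.-group B -> B <| G -> abelian B -> nilpotent (G / 'C_G(B)) ->
    {in G, forall z, p^'.-elt z ->
      exists2 C : {group gT}, cyclic C & {in B, forall b, [~ b, z] \in C}} ->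
  exists U : {group gT}, [/\ cyclic U, U \subset B, G \subset 'N(U)
    & {in B & G, forall b z, p^'.-elt z -> [~ b, z] \in U}].
Proof.
move=> pB nBG abB nilG cycB; have [sBG nB] := andP nBG; have nBg := subsetP nB.
have [/forall_inP cB|] := boolP [forall z in G, p^'.-elt z ==> (z \in 'C(B))].
  exists 1%G; rewrite cyclic1 sub1G norms1; split=> // b z Bb Gz p'z.
  have /centP cBz := implyP (cB z Gz) p'z; rewrite inE.
  by apply/commgP/commute_sym/cBz.
rewrite negb_forall_in => /exists_inP[z0 Gz0]; rewrite negb_imply => /andP[p'z0 ncz0].
set D := 'C_G(B)%G in nilG.
have nDG: G \subset 'N(D) by rewrite normsI ?normG ?norms_cent.
have nD := subsetP nDG.
have actE g g' b : g \in G -> g' \in G -> coset D g = coset D g' -> b \in B ->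
  b ^ g = b ^ g'.
- move=> Gg Gg' eqg Bb; have: g * g'^-1 \in D.
    apply: coset_idr; first by rewrite groupM ?groupV ?nD.
    by rewrite morphM ?groupV ?nD // morphV ?nD //= eqg mulgV.
  case/setIP=> _ /centP/(_ b Bb) cb; rewrite -[g](mulgKV g') conjgM.
  by congr (_ ^ _); apply/conjg_fixP/commgP/commute_sym.
(* The nilpotent group G / C_G(B) has a nontrivial p'-core, which meets the
   centre; any lift is replaced by its p'-part. *)
have [h [Gh p'h ncBh cDh]]: exists h, [/\ h \in G, p^'.-elt h, h \notin 'C(B)
    & coset D h \in 'Z(G / D)].
  have ntO: 'O_p^'(G / D) != 1.
    apply/trivgPn; exists (coset D z0).
      rewrite (mem_Hall_pcore (nilpotent_pcore_Hall _ nilG)) ?mem_quotient //.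
      by rewrite morph_p_elt ?nD.
    apply: contra ncz0 => /eqP/coset_idr; rewrite nD // => /(_ isT).
    by case/setIP.
  have [h' /setIP[Oh' Zh'] nth'] :=
    trivgPn _ (meet_center_nil nilG (pcore_normal _ _) ntO).
  have Gh' : h' \in G / D by case/setIP: Zh'.
  have [h0 Nh0 Gh0 def_h'] := morphimP Gh'.
  have eq_h: coset D h0.`_p^' = h'.
    rewrite morph_constt // def_h' constt_p_elt //= -/(coset D h0).
    by rewrite -[coset D h0]def_h'; apply: mem_p_elt (pcore_pgroup _ _) Oh'.
  have Gh: h0.`_p^' \in G by rewrite /constt groupX.
  exists h0.`_p^'; rewrite eq_h p_elt_constt; split=> //.
  apply: contra nth' => cBh; rewrite -eq_h; apply/eqP/coset_id.
  by rewrite inE Gh.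
have nBh := nBg h Gh.
have coBh : coprime #|B| #[h] by apply: pnat_coprime pB p'h.
pose U := (commg_morphism abB nBh @* B)%G.
have sUB: U \subset B := commg_im_sub abB nBh.
have Ureg u : u \in U -> [~ u, h] = 1 -> u = 1.
  exact: (commg_im_regular coBh).
have fixh g : g \in G -> coset D (g ^ h) = coset D g.
  move=> Gg; rewrite morphJ ?nD //=; apply/conjg_fixP/commgP.
  case/setIP: cDh => _ /centP cDh; apply/commute_sym.
  by apply: cDh; rewrite mem_quotient.
have fixg g : g \in G -> coset D (h ^ g) = coset D h.
  move=> Gg; rewrite morphJ ?nD //=; apply/conjg_fixP/commgP.
  by case/setIP: cDh => _ /centP cDh; apply: cDh; rewrite mem_quotient.
have nUG: G \subset 'N(U).
  apply/subsetP=> g Gg; rewrite inE; apply/subsetP.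
  move=> _ /imsetP[_ /morphimP[b Bb _ ->] ->].
  have Bbg: b ^ g \in B by rewrite memJ_norm ?nBg.
  rewrite /= conjRg commgEl (actE (h ^ g) h) ?fixg // ?groupJ // -commgEl.
  exact: mem_commg_im.
have nU := subsetP nUG.
(* The p-subgroups of a cyclic group are totally ordered, so one of [u, y] and
   [t, y] generates a subgroup that contains the other. *)
have key y u t : y \in G -> p^'.-elt y -> u \in U -> [~ u, y] != 1 -> t \in B ->
  [~ t, h] = 1 -> [~ t, y] = 1.
- move=> Gy p'y Uu nt_uy Bt th1.
  have nBy := nBg y Gy.
  have Bu := subsetP sUB u Uu.
  have [C cycC sC] := cycB y Gy p'y.
  set u1 := [~ u, y] in nt_uy; set t1 := [~ t, y].
  have Uu1: u1 \in U by rewrite /u1 commgEl groupM ?groupV // memJ_norm ?nU.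
  have Bu1 := subsetP sUB _ Uu1.
  have Bt1: t1 \in B by apply: commg_mem_abelian.
  have t1h: commute t1 h.
    apply/commgP/conjg_fixP; rewrite conjRg commgEl.
    have ->: t ^ h = t by apply/conjg_fixP/eqP.
    by rewrite (actE (y ^ h) y) ?fixh // ?groupJ // -commgEl.
  have [i ou1] := p_natP (mem_p_elt pB Bu1).
  have [l ot1] := p_natP (mem_p_elt pB Bt1).
  have [le | le] := leqP i l.
    have: <[u1]> \subset <[t1]>.
      rewrite -(cardSg_cyclic cycC) ?cycle_subG ?sC //.
      by rewrite -!orderE ou1 ot1 dvdn_exp2l.
    rewrite cycle_subG => /cycleP[k def_u1]; case/eqP: nt_uy; apply: Ureg => //.
    by apply/eqP/commgP; rewrite def_u1; apply/commute_sym/commuteX/commute_sym.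
  have: <[t1]> \subset <[u1]>.
    rewrite -(cardSg_cyclic cycC) ?cycle_subG ?sC //.
    by rewrite -!orderE ou1 ot1 dvdn_exp2l // ltnW.
  rewrite cycle_subG => t1u1; apply: Ureg; last exact/eqP/commgP.
  by apply: subsetP t1u1; rewrite cycle_subG.
exists U; split=> //.
  have [C cycC sC] := cycB h Gh p'h.
  by apply: cyclicS cycC; apply/subsetP=> _ /morphimP[b Bb _ ->]; apply: sC.
move=> b z Bb Gz p'z.
have [u Uu eq_bu] := commg_im_surj abB nBh coBh Bb.
have Bu := subsetP sUB u Uu.
pose t := u^-1 * b; have Bt: t \in B by rewrite groupM ?groupV.
have th1: [~ t, h] = 1.
  have /= -> := commgM_abelian abB nBh (groupVr Bu) Bb.
  by have /= -> := morphV (commg_morphism abB nBh) Bu; rewrite eq_bu mulVg.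
have ->: b = u * t by rewrite mulKVg.
have /= -> := commgM_abelian abB (nBg z Gz) Bu Bt.
have Uuz: [~ u, z] \in U by rewrite commgEl groupM ?groupV // memJ_norm ?nU.
suff ->: [~ t, z] = 1 by rewrite mulg1.
have [/exists_inP[v Uv ntv] | ] := boolP [exists v in U, [~ v, z] != 1].
  exact: key ntv Bt th1.
rewrite negb_exists_in => /forall_inP cUz.
pose y := (z * h).`_p^'.
have Gzh: z * h \in G by rewrite groupM.
have Gy: y \in G by rewrite /y /constt groupX.
have eq_y: coset D y = coset D (z * h).
  rewrite morph_constt ?nD //= constt_p_elt // morphM ?nD //=.
  apply: p_eltM; rewrite ?morph_p_elt ?nD //.
  by case/setIP: cDh => _ /centP cDh; apply/commute_sym/cDh; rewrite mem_quotient.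
have [b0 Bb0 ntb0]: exists2 b0, b0 \in B & [~ b0, h] != 1.
  apply/exists_inP; apply: contraR ncBh; rewrite negb_exists_in => /forall_inP cBh.
  by apply/centP=> a Ba; apply/commute_sym/commgP; rewrite -[_ == _]negbK cBh.
set v := [~ b0, h] in ntb0; have Uv: v \in U by apply: mem_commg_im.
have Bv := subsetP sUB v Uv.
have vz: v ^ z = v by apply/conjg_fixP; rewrite -[_ == _]negbK cUz.
have ty1: [~ t, y] = 1.
  apply: (key y v t) => //; first exact: p_elt_constt.
  apply: contra ntb0 => /eqP vy; apply/eqP/Ureg => //.
  by rewrite -vy !commgEl (actE y _ _ _ _ eq_y) // conjgM vz.
have tzh: t ^ (z * h) = t ^ h.
  rewrite -(actE y _ _ _ _ eq_y) //.
  have ->: t ^ y = t by apply/conjg_fixP/eqP.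
  by apply/esym/conjg_fixP/eqP.
by apply/eqP/conjg_fixP; apply: (conjg_inj h); rewrite -conjgM.
Qed.

(** * The case of an abelian gamma_star *)

(** Every element of [A, y] is again the commutator of an element of [A, y] with
    y, so it can be written [a, y, ..., y] with any number of entries y. *)
Lemma commg_gamma_star_comm (gT : finGroupType) j (G A : {group gT}) a y :
    abelian A -> A \subset G -> y \in G -> y \in 'N(A) -> coprime #|A| #[y] ->
  a \in A -> [~ a, y] \in gamma_star_comm j G.
Proof.
move=> abA sAG Gy nAy coAy.
case: j => [|j]; first by move=> Aa; rewrite groupR // (subsetP sAG).
elim: j a => [|j IH] a Aa; first by rewrite groupR // (subsetP sAG).
have [_ /morphimP[v Av _ ->] ->] := commg_im_surj abA nAy coAy Aa.
apply/gamma_star_commP; exists [~ v, y], [~ v, y], y; split=> //=.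
- exact: IH.
- exact: cycle_id.
by apply: coprime_dvdl coAy; rewrite order_dvdG // commg_mem_abelian.
Qed.

(** In an abelian group it is enough to treat one prime p.  With r the p'-part of
    #|K|, the r-th powers form the Sylow p-subgroup P of K, so B is P ^ n written
    without choosing p-parts.  The cyclic group U contains all [b, z] with b in B
    and z a p'-element, and N, the group of the x with x ^ e in U, satisfies
    [K, z] <= N.  In the p-group K / N the commutators of coprime elements are
    trivial by commg_p_elt1, so that N = K. *)
Lemma abelian_gamma_star_cyclic (gT : finGroupType) j m (G : {group gT}) :
    covered m (gamma_star_comm j G) -> abelian (gamma_star j G) ->
  cyclic (power_group G j m`!).
Proof.
set n := m`!; move=> covX abK; set Q := power_group G j n.
have [X_G | j_gt1] : gamma_star_comm j G = G \/ j = j.-2.+2.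
  by case: (j) => [|[|j']]; [left | left | right].
  (* For j <= 1 the whole group G is covered, and G = K is abelian. *)
  have [C cycC sC] : exists2 C : {group gT}, cyclic C & {in G, forall a, a ^+ n \in C}.
    apply: covered_abelian_exp; last by rewrite -{1}X_G.
    by rewrite /gamma_star X_G genGid in abK.
  apply: cyclicS cycC; rewrite gen_subG X_G.
  by apply/subsetP=> _ /imsetP[x Gx ->]; apply: sC.
set K := gamma_star_group j G; have sKG: K \subset G := gamma_star_sub j G.
have nKG: K <| G := gamma_star_normal j G.
have abQ: abelian Q := abelianS (power_group_sub_gamma G j n) abK.
apply: nil_Zgroup_cyclic (abelian_nil abQ).
apply/forall_inP=> S /SylowP[p p_pr sylS].
pose r := (#|K|`_p^')%N; pose e := (n * r)%N; pose P := 'O_p(K)%G.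
have pP: p.-group P := pcore_pgroup p K.
have sylP: p.-Hall(K) P := nilpotent_pcore_Hall p (abelian_nil abK).
have nPG: P <| G := char_normal_trans (pcore_char p K) nKG.
have sPG := normal_sub nPG; have sPK: P \subset K := pcore_sub p K.
have abP: abelian P := abelianS sPK abK.
have powP k : k \in K -> k ^+ r \in P.
  move=> Kk; rewrite (mem_Hall_pcore sylP) ?groupX //.
  by rewrite p_elt_exp partn_dvd // order_dvdG.
pose B := (expg_morphism abK e @* K)%G.
have BP b : b \in B -> exists2 a, a \in P & b = a ^+ n.
  case/morphimP=> k Kk _ ->; exists (k ^+ r); first exact: powP.
  by rewrite /= /e mulnC expgM.
have sBP: B \subset P by apply/subsetP=> b /BP[a Pa ->]; rewrite groupX.
have sBK := subset_trans sBP sPK.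
have nBG: B <| G.
  rewrite /normal (subset_trans sBK) //=; apply/subsetP=> g Gg; rewrite inE.
  apply/subsetP=> _ /imsetP[_ /morphimP[k Kk _ ->] ->]; rewrite /= conjXg.
  apply: (mem_morphim (expg_morphism abK e)) => //.
    by rewrite memJ_norm // (subsetP (normal_norm nKG)).
  by rewrite memJ_norm // (subsetP (normal_norm nKG)).
have [U [cycU sUB nUG UB]] : exists U : {group gT},
    [/\ cyclic U, U \subset B, G \subset 'N(U)
      & {in B & G, forall b z, p^'.-elt z -> [~ b, z] \in U}].
  apply: cyclic_commutators_in_cyclic => //.
  - exact: pgroupS pP.
  - exact: abelianS abP.
  - apply: (@gamma_star_trivial_nilpotent _ j (G / 'C_G(B))).
    rewrite quotient_gamma_star_comm ?normsI ?normG ?norms_cent ?normal_norm //.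
    apply/subsetP=> _ /morphimP[x Nx Xx ->]; rewrite inE; apply/eqP/coset_id.
    rewrite inE (subsetP (gamma_star_comm_sub j G)) //=.
    by apply: (subsetP (centsS sBK abK)); apply: mem_gen.
  move=> z Gz p'z; have nPz := subsetP (normal_norm nPG) z Gz.
  have coPz: coprime #|P| #[z] by apply: pnat_coprime pP p'z.
  have sIX: commg_morphism abP nPz @* P \subset gamma_star_comm j G.
    apply/subsetP=> _ /morphimP[a Pa _ ->]; rewrite /=.
    exact: commg_gamma_star_comm abP _ _ _ _ Pa.
  have [C cycC sC] := covered_abelian_exp (morphim_abelian _ abP) (coveredS sIX covX).
  exists C => // b /BP[a Pa ->].
  by rewrite (commgX_abelian abP nPz) // sC // mem_commg_im.
pose N := (expg_morphism abK e @*^-1 U)%G.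
have memN x : (x \in N) = (x \in K) && (x ^+ e \in U).
  by rewrite inE [X in _ && X]inE.
have nNG: G \subset 'N(N).
  apply/subsetP=> g Gg; rewrite inE; apply/subsetP=> _ /imsetP[x Nx ->].
  move: Nx; rewrite !memN -conjXg => /andP[Kx Ux].
  by rewrite !memJ_norm ?Kx // ?(subsetP nUG) // (subsetP (normal_norm nKG)).
have nN := subsetP nNG.
have sXN: gamma_star_comm j G \subset N.
  apply/subsetP=> x Xx; have Kx: x \in K by apply: mem_gen.
  have Gx := subsetP sKG x Kx.
  have p_x: p.-elt (coset N x).
    apply: pnat_dvd (part_pnat p #|K|); rewrite order_dvdn -morphX ?nN //=.
    apply/eqP/coset_id; rewrite memN groupX // -expgM /e mulnCA partnC ?cardG_gt0 //.
    by rewrite mulnC expgM expg_cardG // expg1n group1.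
  have com z : z \in G -> p^'.-elt z -> commute (coset N x) (coset N z).
    move=> Gz p'z; apply/commgP; rewrite -morphR ?nN //=.
    have nKz := subsetP (normal_norm nKG) z Gz.
    apply/eqP/coset_id; rewrite memN commg_mem_abelian //=.
    rewrite -(commgX_abelian abK nKz) // UB //.
    exact: (mem_morphim (expg_morphism abK e)).
  move: Xx com p_x (nN x Gx); rewrite j_gt1.
  case/gamma_star_commP=> c [a [b [Xc ac Gb co ->]]] com p_x Nx.
  have Ga: a \in G.
    apply: subsetP ac; rewrite cycle_subG.
    exact: subsetP (gamma_star_comm_sub _ _) c Xc.
  apply: coset_idr => //; rewrite morphR ?nN //; rewrite !morphR ?nN //= in p_x com.
  apply: (commg_p_elt1 p_x).
  have [p'b | p_b] := boolP (p^'.-elt b).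
    by right; rewrite morph_p_elt ?nN //; split=> //; apply: com.
  have p'a := coprime_p'_elt p_pr co p_b.
  by left; rewrite morph_p_elt ?nN //; split=> //; apply: com.
have Ue k : k \in K -> k ^+ e \in U.
  move=> Kk; have: k \in N by apply: subsetP Kk; rewrite gen_subG.
  by rewrite memN => /andP[].
apply: cyclicS cycU; apply/subsetP=> s Ss.
(* A p-element s is a power of s ^ r, since r is prime to p. *)
have p_s := mem_p_elt (pHall_pgroup sylS) Ss.
have [k Kk def_s] : exists2 k, k \in K & s = k ^+ n.
  have: s \in expg_morphism abK n @* K.
    apply: subsetP (subsetP (pHall_sub sylS) s Ss); rewrite gen_subG.
    apply/subsetP=> _ /imsetP[x Xx ->].
    by apply: (mem_morphim (expg_morphism abK n)); apply: mem_gen.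
  by case/morphimP=> k Kk _ ->; exists k.
have Usr: s ^+ r \in U by rewrite def_s -expgM Ue.
have: generator <[s]> (s ^+ r).
  by rewrite generator_coprime (pnat_coprime p_s) // part_pnat.
move/eqP=> eq_s; have: s \in <[s]> := cycle_id s.
by rewrite eq_s; apply: subsetP; rewrite cycle_subG.
Qed.

(** * Bounding the derived subgroup *)

(** The automorphism group of a cyclic group is abelian. *)
Lemma norm_cycle_der1_cent (gT : finGroupType) (M : {group gT}) x :
  M \subset 'N(<[x]>) -> M^`(1) \subset 'C[x].
Proof.
move=> nxM; have conj_x g : g \in M -> exists i, x ^ g = x ^+ i.
  by move=> Mg; apply/cycleP; rewrite memJ_norm ?cycle_id ?(subsetP nxM).
rewrite gen_subG; apply/subsetP=> _ /imset2P[g h Mg Mh ->].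
have [i xg] := conj_x g Mg; have [k xh] := conj_x h Mh.
have [l xl] := conj_x _ (groupM (groupVr Mg) (groupVr Mh)).
apply/cent1P/commute_sym/commgP/conjg_fixP.
have ->: [~ g, h] = (g^-1 * h^-1) * (g * h) by rewrite /commg /conjg !mulgA.
have comm_gh: x ^ (g * h) = x ^ (h * g).
  by rewrite !conjgM xg xh !conjXg xg xh -!expgM mulnC.
by rewrite conjgM xl conjXg comm_gh -conjXg -xl -conjgM -invMg mulVg conjg1.
Qed.

Lemma quotient_power_group (gT : finGroupType) (G N : {group gT}) j e :
  G \subset 'N(N) -> power_group (G / N) j e = power_group G j e / N :> {set _}.
Proof.
move=> nNG; have sXN := subset_trans (gamma_star_comm_sub j G) nNG.
rewrite /= quotient_gen; last first.
  by apply/subsetP=> _ /imsetP[x Xx ->]; rewrite groupX // (subsetP sXN).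
congr <<_>>; rewrite quotient_gamma_star_comm //.
apply/setP=> y; apply/imsetP/idP => [[_ /morphimP[x Nx Xx ->] ->] | ].
  by rewrite -morphX //; apply: mem_morphim; [apply: groupX | apply: imset_f].
case/morphimP=> _ _ /imsetP[x Xx ->] ->; have Nx := subsetP sXN x Xx.
by exists (coset N x); rewrite ?mem_morphim // -morphX.
Qed.

(** The factor of n in the exponent e is a multiple of every order that
    #|K' / M'| can have, where M is generated by the n-th powers of the commutators. *)
Definition der1_bound m :=
  let n := m`! in
  let e := (n * (schur_bound (dietzmann_bound m (n * n * n)))`!)%N in
  schur_bound (dietzmann_bound m (e * n * e)).

Section Main.

Variables (gT : finGroupType) (G : {group gT}) (j m : nat).
Local Notation X := (gamma_star_comm j G).
Local Notation K := (gamma_star_group j G).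
Local Notation n := (m`!).
Hypothesis covX : covered m X.

Let sKG : K \subset G := gamma_star_sub j G.
Let nKG : K <| G := gamma_star_normal j G.

Lemma power_group_der1_central : (power_group G j n)^`(1) \subset 'C(K).
Proof.
rewrite cent_gamma_star; apply/subsetP=> c M'c; apply/centP=> x Xx.
apply/cent1P; apply: subsetP M'c; apply: norm_cycle_der1_cent.
rewrite gen_subG; apply/subsetP=> _ /imsetP[y Xy ->].
by apply: (expg_fact_norm_cycle covX); rewrite // (subsetP (gamma_star_comm_sub j G)).
Qed.

(** With M generated by the n-th powers, M' is central in M, and M / M' is an
    extension of the bounded group M :&: K' / M' by a cyclic group.  So M has an
    abelian subgroup T = <u> M' which contains the q-th powers of all
    elements of M, where q = #|K' / M'|.  Since x ^ n is in M for every x in X,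
    raising the exponent from n to a multiple of n * q makes the power group abelian. *)
Lemma gamma_star_der1_bound : #|K^`(1)| <= der1_bound m.
Proof.
pose M := power_group G j n; pose M' := M^`(1)%G; pose K' := K^`(1)%G.
have n_gt0 : 0 < n := fact_gt0 m.
have nMG : M <| G := power_group_normal G j n.
have sMK : M \subset K := power_group_sub_gamma G j n.
have nM'G : M' <| G := char_normal_trans (der_char 1 M) nMG.
have nK'G : K' <| G := char_normal_trans (der_char 1 K) nKG.
set S1 := schur_bound (dietzmann_bound m (n * n * n)).
have le_q : #|K' / M'| <= S1.
  have := @abelian_power_group_der1_bound _ (G / M') j m _ n n_gt0.
  rewrite quotient_power_group ?normal_norm // quotient_gamma_star ?normal_norm //.
  rewrite -quotient_der ?(subset_trans sKG) ?normal_norm //.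
  apply; last exact: sub_der1_abelian.
  by rewrite quotient_gamma_star_comm ?normal_norm //; apply: quotient_covered.
set q := #|K' / M'| in le_q.
have q_dvd : q %| S1`! by rewrite dvdn_fact // le_q cardG_gt0.
have cycM : cyclic (M / K').
  have := @abelian_gamma_star_cyclic _ j m (G / K').
  rewrite quotient_power_group ?normal_norm // quotient_gamma_star ?normal_norm //.
  apply; last exact: sub_der1_abelian.
  by rewrite quotient_gamma_star_comm ?normal_norm //; apply: quotient_covered.
have sMG := normal_sub nMG.
have nK' := subsetP (subset_trans sMG (normal_norm nK'G)).
have nM' := subsetP (subset_trans sMG (normal_norm nM'G)).
have [u Mu genM]: exists2 u, u \in M & M / K' = <[coset K' u]>.
  have [u' defM] := cyclicP cycM; have: u' \in M / K' by rewrite defM cycle_id.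
  by case/morphimP=> u _ Mu def_u; exists u; rewrite // defM def_u.
have sM'M: M' \subset M := der_sub 1 M.
have cM'M: M' \subset 'C(M).
  by apply: subset_trans power_group_der1_central (centS sMK).
pose T := (<[u]> <*> M')%G.
have abT : abelian T.
  rewrite abelianY cycle_abelian /= [abelian M'](subset_trans cM'M) ?centS //=.
  by rewrite (subset_trans cM'M) // centS // cycle_subG.
have powT a : a \in M -> a ^+ q \in T.
  move=> Ma; have: coset K' a \in <[coset K' u]>.
    by rewrite -genM; apply: mem_quotient.
  case/cycleP=> k; rewrite -morphX ?nK' //= => eq_a.
  pose c := u ^- k * a; have Mc: c \in M by rewrite groupM ?groupV ?groupX.
  have K'c: c \in K'.
    apply: coset_idr; first exact: nK'.
    have Muk: u ^+ k \in M by rewrite groupX.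
    by rewrite /c morphM ?groupV ?nK' // morphV ?nK' //= eq_a mulVg.
  have M'cq: coset M' (c ^+ q) = 1.
    by rewrite morphX ?nM' //= expg_cardG // mem_quotient.
  have: coset M' (a ^+ q) = coset M' (u ^+ (k * q)).
    have Muk: u ^+ k \in M by rewrite groupX.
    have com: commute (coset M' (u ^+ k)) (coset M' c).
      by apply: (centsP (der_abelian 0 M)); apply: mem_quotient.
    have def_a: coset M' a = coset M' (u ^+ k) * coset M' c.
      by rewrite -morphM ?nM' //= mulKVg.
    rewrite morphX ?nM' //= def_a expgMn //.
    by rewrite -!morphX ?nM' //= M'cq mulg1 expgM.
  move=> eq_aq; have Maq: a ^+ q \in M by rewrite groupX.
  have Mukq: u ^+ (k * q) \in M by rewrite groupX.
  rewrite -[a ^+ q](mulgKV (u ^+ (k * q))) groupM //; last first.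
    by rewrite (subsetP (joing_subl _ _)) // mem_cycle.
  apply: (subsetP (joing_subr <[u]> M')); apply: coset_idr.
    by rewrite nM' // groupM ?groupV.
  by rewrite morphM ?groupV ?nM' // morphV ?nM' //= eq_aq mulgV.
have abMe : abelian (power_group G j (n * S1`!)).
  apply: abelianS abT; rewrite gen_subG; apply/subsetP=> _ /imsetP[x Xx ->].
  have [d ->] := dvdnP q_dvd; rewrite expgM mulnC expgM groupX //.
  by apply: powT; apply: power_groupP.
apply: (abelian_power_group_der1_bound covX _ abMe).
by rewrite muln_gt0 n_gt0 fact_gt0.
Qed.

(** * The bounded normal subgroup with cyclic quotient *)

(** Delta is the preimage of the kernel W of the n-th power map on K / K'; the order
    of W is the index of the image of this map, which the covering bounds. *)
Lemma gamma_star_bounded_by_cyclic :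
  exists Delta : {group gT},
    [/\ Delta \subset K, #|Delta| <= der1_bound m * dietzmann_bound m n,
        Delta <| G & cyclic (K / Delta)].
Proof.
pose K' := K^`(1)%G; have n_gt0 : 0 < n := fact_gt0 m.
have nK'G : K' <| G := char_normal_trans (der_char 1 K) nKG.
have nGK' := normal_norm nK'G.
have sK'K : K' \subset K := der_sub 1 K.
have nK'K : K' <| K := der_normal 1 K.
pose A := (K / K')%G; have abA : abelian A := der_abelian 0 K.
pose phi := expg_morphism abA n; pose P := (power_group G j n / K')%G.
have defP : phi @* A = P.
  apply/eqP; rewrite eqEsubset; apply/andP; split; last first.
    have nK'Q : power_group G j n \subset 'N(K').
      by apply: subset_trans nGK'; apply: normal_sub (power_group_normal G j n).
    rewrite sub_quotient_pre // gen_subG; apply/subsetP=> _ /imsetP[x Xx ->].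
    have Kx : x \in K by apply: mem_gen.
    have Nx := subsetP (normal_norm nK'K) x Kx.
    rewrite mem_morphpre ?groupX // morphX //=.
    by apply: (mem_morphim phi); apply: mem_quotient.
  have sAP: A \subset phi @*^-1 P.
    suff: <<X / K'>> \subset phi @*^-1 P.
      by rewrite -quotient_gen // (subset_trans (gamma_star_comm_sub j G)).
    rewrite gen_subG; apply/subsetP=> _ /morphimP[x Nx Xx ->].
    have Ax: coset K' x \in A by apply/mem_quotient/mem_gen.
    rewrite mem_morphpre //= -morphX //; apply: mem_morphim; first exact: groupX.
    exact: power_groupP.
  by rewrite sub_morphim_pre.
have cycP : cyclic P.
  have := @abelian_gamma_star_cyclic _ j m (G / K').
  rewrite quotient_power_group // quotient_gamma_star //.
  apply; last exact: sub_der1_abelian.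
  by rewrite quotient_gamma_star_comm //; apply: quotient_covered.
pose W := ('ker phi)%G.
have sWA : W \subset A by apply: subsetIl.
have memW a : (a \in W) = (a \in A) && (a ^+ n == 1) by rewrite !inE.
have nWG : G / K' \subset 'N(W).
  apply/subsetP=> g Gg; rewrite inE; apply/subsetP=> _ /imsetP[a Wa ->].
  move: Wa; rewrite !memW -conjXg conjg_eq1 => /andP[Aa ->]; rewrite andbT.
  by rewrite memJ_norm // (subsetP (quotient_norms K' (normal_norm nKG))).
have cardW : #|W| <= dietzmann_bound m n.
  have sPA : P \subset A by apply: quotientS; apply: power_group_sub_gamma.
  have := @gamma_star_quotient_bound _ (G / K') j m _ n P.
  rewrite quotient_gamma_star // => bound.
  have nPA : A \subset 'N(P) by apply: sub_abelian_norm.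
  have -> : #|W| = #|A / P|.
    have eqP_ : #|P| = #|A : W|.
      by rewrite -defP -card_quotient ?ker_norm // (card_isog (first_isog phi)).
    have := etrans (Lagrange sPA) (esym (Lagrange sWA)).
    rewrite eqP_ mulnC => /eqP; rewrite eqn_pmul2r ?indexg_gt0 // => /eqP <-.
    by rewrite card_quotient.
  apply: bound => // [||x].
  - by rewrite quotient_gamma_star_comm //; apply: quotient_covered.
  - by rewrite quotient_norms ?power_group_norm.
  rewrite quotient_gamma_star_comm // => /morphimP[y Ny Xy ->].
  by rewrite -morphX //; apply: mem_morphim; [apply: groupX | apply: power_groupP].
exists (coset K' @*^-1 W)%G; split.
- by rewrite -(quotientGK nK'K) morphpreS.
- by rewrite card_cosetpre leq_mul // gamma_star_der1_bound.
- rewrite -(quotientGK nK'G) cosetpre_normal /normal nWG andbT.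
  exact: subset_trans sWA (quotientS _ sKG).
have isoA: A / W \isog P by rewrite -defP; apply: first_isog.
rewrite -(isog_cyclic isoA) in cycP.
have nWA: W <| A by rewrite /normal sWA (subset_trans _ nWG) ?quotientS.
have sK'D : K' \subset coset K' @*^-1 W by apply: sub_cosetpre.
have nDK : (coset K' @*^-1 W)%G <| K by rewrite -(quotientGK nK'K) cosetpre_normal.
by rewrite -(isog_cyclic (third_isog sK'D nK'K nDK)) cosetpreK.
Qed.

End Main.

Theorem theorem1p1 :
  exists f : nat -> nat,
    forall (j m : nat), 0 < j -> 0 < m ->
    forall (gT : finGroupType) (G : {group gT}) (C : 'I_m -> {group gT}),
      (forall i : 'I_m, C i \subset G) ->
      (forall i : 'I_m, cyclic (C i)) ->
      gamma_star_comm j G \subset \bigcup_(i < m) C i ->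
      exists Delta : {group gT},
        [/\ Delta \subset gamma_star j G,
            #|Delta| <= f m,
            Delta <| G
          & cyclic (gamma_star j G / Delta)].
Proof.
exists (fun m => der1_bound m * dietzmann_bound m m`!)%N => j m _ _ gT G C _ cycC sXC.
by apply: gamma_star_bounded_by_cyclic; exists C.
Qed.
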